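(* For every integer $n\ge 2$, the number of linearly ordered factorizations of the $n$-cycle $(1,2,\dots,n)$ is $$|U_n| = n\,2^{n-3},$$ where $U_n$ denotes the set of all linearly ordered factorizations of $(1,2,\dots,n)$.
   Context: A factorization of the $n$-cycle $(1,2,\dots,n)$ (the permutation $1\mapsto 2\mapsto\cdots\mapsto n\mapsto 1$ in the symmetric group $\mathfrak{S}_n$) is a sequence $(t_1,\dots,t_{n-1})$ of $n-1$ transpositions in $\mathfrak{S}_n$ with $t_1 t_2\cdots t_{n-1}=(1,2,\dots,n)$, where products of permutations are composed from right to left. It is called linearly ordered if, for every $1\le i\le n-2$, the transpositions $t_i$ and $t_{i+1}$ have a common letter (i.e. some element of $\{1,\dots,n\}$ is moved by both). $U_n$ is the set of all linearly ordered factorizations of $(1,2,\dots,n)$. *)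

(* Defs.v *)
From mathcomp Require Import all_boot all_order all_fingroup all_algebra.

Set Implicit Arguments.
Unset Strict Implicit.
Unset Printing Implicit Defensive.

Import GroupScope.

(* The letters 1, ..., n are represented by the elements 0, ..., n-1 of 'I_n;
   ordS is the successor modulo n. *)
Definition long_cycle (n : nat) : 'S_n := perm (@ordS_inj n).

Definition is_transposition (n : nat) (s : 'S_n) : bool :=
  [exists x, exists y, (x != y) && (s == tperm x y)].

(* The product of permutations in perm is composed from left to right,
   (s * t) x = t (s x), hence the reversal: [prod_rl [:: t1; ...; tk]] is the
   function composition t1 \o ... \o tk. *)
Definition prod_rl (n : nat) (ts : seq 'S_n) : 'S_n := \prod_(s <- rev ts) s.

Definition is_factorization (n : nat) (ts : n.-1.-tuple 'S_n) : bool :=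
  all (@is_transposition n) ts && (prod_rl ts == long_cycle n).

Definition common_letter (n : nat) : rel 'S_n :=
  fun s t => [exists x, (s x != x) && (t x != x)].

(* [sorted r] relates consecutive entries only. *)
Definition linearly_ordered (n : nat) (ts : n.-1.-tuple 'S_n) : bool :=
  sorted (@common_letter n) ts.

Definition U (n : nat) : {set n.-1.-tuple 'S_n} :=
  [set ts | is_factorization ts && linearly_ordered ts].

(* Main.v *)
Require Import Defs.
From mathcomp Require Import all_boot all_order all_fingroup all_algebra.
From mathcomp Require Import zify.

Set Implicit Arguments.
Unset Strict Implicit.
Unset Printing Implicit Defensive.

Import GroupScope.

(** Read a linearly ordered factorization in the order in which its factors
    are applied, as c = u_1 * u_2 * ... * u_(n-1) with consecutive factors
    sharing a letter.  The factors u_2, ..., u_(n-1) involve at most n-1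
    letters altogether, whereas c moves n of them.  Hence u_1 contains a letter
    j that no later factor moves, and u_1 must be the transposition (i j) with
    j = c i ([chain_head]).  What remains to be factorized is [contract c i],
    the cycle obtained from c by removing the letter c i.  Its first factor
    must share a letter with (i j), and this letter can only be i.

    So the problem to solve is the following one: given a cycle s of length
    k+2 and a letter a of s, count the chains of k+1 transpositions with
    product s whose first factor moves a.  That factor is (i, s i) with
    i = a or s i = a; these two choices differ as soon as k > 0, and each of
    them leaves the same problem for the cycle [contract s i] of length k+1
    and its letter i.  The count is therefore 2 ^ k; [chains] is the resulting
    enumeration, and [mem_chains], [chains_uniq] and [size_chains] say that
    it is correct.

    Finally, every first factor moves exactly two letters, so summing the
    count 2 ^ (n-2) over all n letters a counts each element of U n twice:
    2 * #|U n| = n * 2 ^ (n-2) ([card_U]). *)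

(** * Letters of a chain of transpositions *)

Section Chains.
Variable n : nat.
Implicit Types (s t u : 'S_n) (us vs : seq 'S_n) (a i j x y : 'I_n).

Definition moved s : {set 'I_n} := [set x | s x != x].

Lemma moved_tperm i j : i != j -> moved (tperm i j) = [set i; j].
Proof.
move=> ij; apply/setP=> x; rewrite !inE; case: tpermP => [->|->|/eqP xi /eqP xj].
- by rewrite eqxx eq_sym ij.
- by rewrite eqxx ij orbT.
- by rewrite eqxx (negbTE xi) (negbTE xj).
Qed.

Lemma card_moved_transposition u : is_transposition u -> #|moved u| = 2.
Proof.
by case/existsP=> x /existsP[y /andP[xy /eqP->]]; rewrite moved_tperm // cards2 xy.
Qed.

Lemma common_letter_sym : symmetric (@common_letter n).
Proof. by move=> s t; apply: eq_existsb => x; rewrite andbC. Qed.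

Definition letters us : {set 'I_n} := \bigcup_(u <- us) moved u.

Lemma letters_nil : letters [::] = set0.
Proof. exact: big_nil. Qed.

Lemma letters_cons u us : letters (u :: us) = moved u :|: letters us.
Proof. exact: big_cons. Qed.

Lemma moved_prod us : moved (\prod_(u <- us) u) \subset letters us.
Proof.
elim: us => [|u us IH].
  by rewrite big_nil; apply/subsetP=> x; rewrite !inE perm1 eqxx.
rewrite big_cons letters_cons; apply/subsetP=> x; rewrite !inE permM.
have [->|//] := eqVneq (u x) x => ux /=.
by apply: (subsetP IH); rewrite inE.
Qed.

(** A chain of transpositions is a connected graph on its letters, so it has
    at most one letter more than it has factors: each new factor brings in at
    most one letter outside the rest of the chain.  The empty chain has no
    letter at all, whence the second summand. *)
Lemma card_letters_chain us :
  all (@is_transposition n) us -> sorted (@common_letter n) us ->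
  #|letters us| <= size us + (us != [::]).
Proof.
elim: us => [|u us IH] /=; first by rewrite letters_nil cards0.
case/andP=> tu tus cus; rewrite letters_cons.
have := IH tus (path_sorted cus).
have := cardsUI (moved u) (letters us).
rewrite (card_moved_transposition tu).
case: us {IH tus} cus => [|v us] /=; first by rewrite letters_nil cards0; lia.
case/andP=> /existsP[x /andP[ux vx]] _.
have : 0 < #|moved u :&: letters (v :: us)|.
  by apply/card_gt0P; exists x; rewrite letters_cons !inE ux vx.
move: #|_ :&: _| #|_ :|: _| #|letters _| => p q r; lia.
Qed.

(** * Removing the first factor *)

(** The list [us] is in the order of application, which is the reverse of the
    order in which [prod_rl] takes its argument. *)
Definition chain_factorization s us :=
  [&& all (@is_transposition n) us, sorted (@common_letter n) us
    & \prod_(u <- us) u == s].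

(** When s is a cycle (... i j k ...), this is the cycle (... i k ...). *)
Definition contract s i := tperm i (s i) * s.

(** The size hypothesis says that s moves as many letters as a chain of this
    length can have.  The first factor (i j) then has a letter j that occurs
    nowhere else in the chain; so i is sent to j and is left there, which
    means that j = s i. *)
Lemma chain_head s u us :
  chain_factorization s (u :: us) -> #|moved s| = (size us).+2 ->
  exists2 i, s i != i & u = tperm i (s i).
Proof.
case/and3P=> /= /andP[tu tus] cus /eqP Ds Ms.
have le_s : #|moved s| <= #|moved u :|: letters us|.
  by rewrite -Ds subset_leq_card // (subset_trans (moved_prod _)) // letters_cons.
have [sub|] := boolP (moved u \subset letters us).
  (* With both letters of u already in the rest of the chain, there would be
     too few letters for s. *)
  have letters_us := card_letters_chain tus (path_sorted cus).
  move: le_s; rewrite (setUidPr sub) Ms => /leq_trans/(_ letters_us).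
  by case: (us != [::]); lia.
case/subsetPn=> j uj nj.
have [i ij Du] : exists2 i, i != j & u = tperm i j.
  case/existsP: tu => x /existsP[y /andP[xy /eqP Du]].
  move: uj; rewrite Du moved_tperm // !inE => /orP[]/eqP->.
    by exists y; rewrite 1?eq_sym // tpermC.
  by exists x.
have si : s i = j.
  rewrite -Ds big_cons permM Du tpermL; apply/eqP; apply: contraNT nj => mj.
  by apply: (subsetP (moved_prod us)); rewrite inE.
by exists i; rewrite si // eq_sym.
Qed.

Lemma chain_consE s i us :
  s i != i ->
  chain_factorization s (tperm i (s i) :: us) =
  path (@common_letter n) (tperm i (s i)) us && chain_factorization (contract s i) us.
Proof.
move=> si; rewrite /chain_factorization /= big_cons.
have -> : is_transposition (tperm i (s i)).
  by apply/existsP; exists i; apply/existsP; exists (s i); rewrite eq_sym si eqxx.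
have -> : (tperm i (s i) * \prod_(u <- us) u == s) = (\prod_(u <- us) u == contract s i).
  by rewrite /contract (can2_eq (mulKg _) (mulKVg _)) tpermV.
have [P|] /= := boolP (path _ _ us); last by rewrite andbF.
by rewrite (path_sorted P).
Qed.

(** * Cycles and their contractions *)

Definition single_cycle s := {in moved s &, forall x y, y \in porbit s x}.

Lemma single_cycle_ind s i (P : pred 'I_n) :
  single_cycle s -> s i != i -> P i -> (forall x, P x -> P (s x)) ->
  {in moved s, forall x, P x}.
Proof.
move=> cs si Pi Ps x sx.
have /porbitP[m ->] : x \in porbit s i by apply: cs => //; rewrite inE.
by elim: m => [|m IH]; rewrite ?perm1 // expgSr permM Ps.
Qed.

(** Only for a cycle of length 2 do s i and s^-1 i coincide. *)
Lemma single_cycle_not_inv s i :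
  single_cycle s -> 2 < #|moved s| -> s i != i -> s (s i) != i.
Proof.
move=> cs lt2 si; apply: contraTneq lt2 => ssi; rewrite -leqNgt.
have sub : moved s \subset [set i; s i].
  apply/subsetP; apply: (single_cycle_ind cs si); first by rewrite !inE eqxx.
  by move=> x; rewrite !inE => /orP[]/eqP->; rewrite ?ssi eqxx ?orbT.
by apply: leq_trans (subset_leq_card sub) _; rewrite cards2; case: (_ != _).
Qed.

Lemma contract_fix s i : contract s i (s i) = s i.
Proof. by rewrite permM tpermR. Qed.

Lemma contract_id s i : contract s i i = s (s i).
Proof. by rewrite permM tpermL. Qed.

Lemma contract_out s i x : x != i -> x != s i -> contract s i x = s x.
Proof. by move=> xi xsi; rewrite permM tpermD // eq_sym. Qed.

Lemma moved_contract s i :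
  single_cycle s -> 2 < #|moved s| -> s i != i ->
  moved (contract s i) = moved s :\ s i.
Proof.
move=> cs lt2 si; apply/setP=> x; rewrite !inE.
have [->|xsi] := eqVneq x (s i); first by rewrite contract_fix eqxx.
have [->|xi] := eqVneq x i; first by rewrite contract_id si single_cycle_not_inv.
by rewrite contract_out.
Qed.

Lemma card_moved_contract s i k :
  single_cycle s -> #|moved s| = k.+3 -> s i != i ->
  #|moved (contract s i)| = k.+2.
Proof.
move=> cs Ms si; rewrite moved_contract ?Ms //.
by have := cardsD1 (s i) (moved s); rewrite Ms inE (inj_eq perm_inj) si => -[].
Qed.

(** Following the s-orbit of i, one stays in the orbit of i under the
    contraction, except for the visit to the removed letter s i. *)
Lemma single_cycle_contract s i :
  single_cycle s -> 2 < #|moved s| -> s i != i -> single_cycle (contract s i).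
Proof.
move=> cs lt2 si.
have orb x : x \in moved (contract s i) -> x \in porbit (contract s i) i.
  rewrite moved_contract // !inE => /andP[xsi sx].
  suff : (x == s i) || (x \in porbit (contract s i) i) by rewrite (negbTE xsi).
  have {sx} sx : x \in moved s by rewrite inE.
  move: x sx {xsi}; apply: (single_cycle_ind cs si); first by rewrite porbit_id orbT.
  move=> x /orP[/eqP->|xi]; first by rewrite -contract_id (mem_porbit _ 1) ?orbT.
  have [->|nxi] := eqVneq x i; first by rewrite eqxx.
  have [->|nxsi] := eqVneq x (s i).
    by rewrite -contract_id (mem_porbit _ 1) orbT.
  rewrite -(contract_out nxi nxsi) orbC.
  by move: xi; rewrite -!eq_porbit_mem (porbit_perm _ 1) => ->.
by move=> x y /orb; rewrite -eq_porbit_mem => /eqP-> /orb.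
Qed.

(** * Enumeration of the chain factorizations of a cycle *)

(** The factorizations of a cycle s of length k+2 into a chain of k+1
    transpositions, the first of which moves a.  The two values of i are those
    for which (i, s i) contains a.  For k = 0 they give the same
    transposition, hence the separate base case. *)
Fixpoint chains k s a : seq (seq 'S_n) :=
  if k is k'.+1 then
    [seq tperm i (s i) :: us | i <- [:: a; s^-1 a], us <- chains k' (contract s i) i]
  else [:: [:: tperm a (s a)]].

Lemma size_chains k s a : size (chains k s a) = (2 ^ k)%N.
Proof.
elim: k s a => //= k IH s a.
by rewrite !size_cat !size_map !IH addn0 expnS mul2n addnn.
Qed.

Lemma tperm_step_inj s i j :
  single_cycle s -> 2 < #|moved s| -> s i != i -> s j != j ->
  tperm i (s i) = tperm j (s j) -> i = j.
Proof.
move=> cs lt2 si sj /permP/(_ i); rewrite tpermL.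
case: tpermP => // [->|_ _ /eqP]; last by rewrite (negbTE si).
by move/eqP; rewrite (negbTE (single_cycle_not_inv cs lt2 sj)).
Qed.

Lemma moved_permV s a : s a != a -> s (s^-1 a) != s^-1 a.
Proof. by move=> sa; rewrite permKV -(inj_eq (@perm_inj _ s)) permKV. Qed.

Lemma chains_uniq k s a :
  single_cycle s -> #|moved s| = k.+2 -> s a != a -> uniq (chains k s a).
Proof.
elim: k s a => // k IH s a cs Ms sa.
have lt2 : 2 < #|moved s| by rewrite Ms.
have si i : i \in [:: a; s^-1 a] -> s i != i.
  by rewrite !inE => /orP[]/eqP-> //; apply: moved_permV.
apply: allpairs_uniq_dep => [|i /si mi|].
- by rewrite /= inE andbT -(inj_eq (@perm_inj _ s)) permKV.
- apply: IH.
  + exact: single_cycle_contract.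
  + exact: card_moved_contract.
  + by rewrite contract_id single_cycle_not_inv.
move=> _ _ /allpairsPdep[i [us [/si mi _ ->]]] /allpairsPdep[j [vs [/si mj _ ->]]] /=.
by case=> /(tperm_step_inj cs lt2 mi mj) <- <-.
Qed.

Lemma moved2_tperm s a : #|moved s| = 2 -> s a != a -> s = tperm a (s a).
Proof.
move=> Ms sa.
have Dm : moved s = [set a; s a].
  apply/esym/eqP; rewrite eqEcard Ms cards2 (eq_sym a) sa leqnn andbT.
  by apply/subsetP=> x; rewrite !inE => /orP[]/eqP->; rewrite ?(inj_eq perm_inj).
have fix_s x : x \notin [set a; s a] -> s x = x.
  by rewrite -Dm inE negbK => /eqP.
apply/permP=> x; case: tpermP => [->|->|/eqP xa /eqP xsa] //.
  have: s (s a) \in [set a; s a] by rewrite -Dm inE !(inj_eq perm_inj).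
  by rewrite !inE !(inj_eq perm_inj) (negbTE sa) orbF => /eqP.
by apply: fix_s; rewrite !inE negb_or xa.
Qed.

(** The condition on the first factor reproduces itself: the letters of the
    second factor are letters of [contract s i], hence differ from s i, so the
    letter that it shares with (i, s i) is i. *)
Lemma mem_chains k s a us :
  single_cycle s -> #|moved s| = k.+2 -> s a != a ->
  (us \in chains k s a) =
    [&& size us == k.+1, chain_factorization s us & head 1 us a != a].
Proof.
elim: k s a us => [|k IH] s a us cs Ms sa.
  have Ds := moved2_tperm Ms sa; rewrite /= inE -Ds.
  apply/eqP/idP => [->|].
    rewrite /chain_factorization /= big_seq1 eqxx sa !andbT.
    by apply/existsP; exists a; apply/existsP; exists (s a); rewrite eq_sym sa -Ds /=.
  case: us => [|u [|]] //=; case/andP=> cf _; case/and3P: cf => _ _.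
  by rewrite big_seq1 => /eqP->.
have lt2 : 2 < #|moved s| by rewrite Ms.
have cs' i : s i != i -> single_cycle (contract s i) by exact: single_cycle_contract.
have Ms' i : s i != i -> #|moved (contract s i)| = k.+2 by exact: card_moved_contract.
have si' i : s i != i -> contract s i i != i.
  by rewrite contract_id; exact: single_cycle_not_inv.
apply/allpairsPdep/idP => [[i [vs [ai ivs ->]]]|].
  have si : s i != i by move: ai; rewrite !inE => /orP[]/eqP-> //; apply: moved_permV.
  move: ivs; rewrite (IH _ _ _ (cs' _ si) (Ms' _ si) (si' _ si)); case/and3P=> /eqP sz cf hi.
  rewrite /= sz eqxx chain_consE // cf andbT /=; apply/andP; split.
    case: vs hi {sz} cf => [|v vs]; rewrite /= ?perm1 ?eqxx // => hi cf.
    case/and3P: cf => _ /= -> _; rewrite andbT.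
    by apply/existsP; exists i; rewrite tpermL si.
  move: ai; rewrite !inE => /orP[]/eqP Di; first by rewrite -Di tpermL.
  by rewrite Di permKV tpermR -(inj_eq (@perm_inj _ s)) permKV eq_sym.
case: us => [|u vs] //= /and3P[/eqP[sz] cf ua].
have [|i si Du] := chain_head cf; first by rewrite Ms sz.
subst u; move: cf; rewrite chain_consE // => /andP[pvs cf].
exists i, vs; split=> //.
  move: ua; rewrite !inE; case: tpermP => [->|->|]; rewrite ?eqxx //.
  by rewrite permK eqxx orbT.
rewrite (IH _ _ _ (cs' _ si) (Ms' _ si) (si' _ si)) sz eqxx cf /=.
case: vs sz cf pvs => [|v vs] //= [sz] cf /andP[/existsP[x /andP[ux vx]] _].
have [|j sj Dv] := chain_head cf; first by rewrite Ms' ?sz.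
have: x \in moved (contract s i).
  rewrite inE; move: vx; rewrite Dv.
  by case: tpermP => [-> _|-> _|]; rewrite ?eqxx ?(inj_eq perm_inj).
rewrite moved_contract // !inE => /andP[xsi _].
by move: ux; case: tpermP vx xsi => [->|->|]; rewrite ?eqxx //.
Qed.

(** * The long cycle *)

Lemma long_cycle_expE m (x : 'I_n) : (long_cycle n ^+ m) x = (x + m) %% n :> nat.
Proof.
elim: m => [|m IH]; first by rewrite perm1 addn0 modn_small.
by rewrite expgSr permM permE /= IH -[in LHS]addn1 modnDml addn1 addnS.
Qed.

Lemma long_cycle_single : single_cycle (long_cycle n).
Proof.
move=> x y _ _; apply/porbitP; exists (y + n - x); apply: val_inj => /=.
rewrite long_cycle_expE subnKC; first by rewrite modnDr modn_small.
by rewrite (leq_trans (ltnW (ltn_ord x))) // leq_addl.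
Qed.

Lemma long_cycle_moves (x : 'I_n) : 1 < n -> long_cycle n x != x.
Proof.
move=> n_gt1; rewrite permE -val_eqE /=.
have := ltn_ord x; rewrite leq_eqVlt => /orP[/eqP Dn|ltxn].
  by rewrite Dn modnn; apply: contraTneq n_gt1 => x0; rewrite -Dn -x0.
by rewrite modn_small // neq_ltn ltnSn orbT.
Qed.

Lemma card_moved_long_cycle : 1 < n -> #|moved (long_cycle n)| = n.
Proof.
move=> n_gt1; rewrite -[RHS]card_ord -cardsT; congr #|pred_of_set _|.
by apply/setP=> x; rewrite !inE long_cycle_moves.
Qed.

End Chains.

(** * Counting *)

Lemma mem_U n (ts : n.-1.-tuple 'S_n) :
  (ts \in U n) = chain_factorization (long_cycle n) (rev ts).
Proof.
rewrite inE /is_factorization /linearly_ordered /chain_factorization all_rev rev_sorted.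
rewrite -andbA [X in _ && X]andbC; congr [&& _, _ & _].
by apply: eq_sorted => s t; rewrite common_letter_sym.
Qed.

Lemma card_U_letter k (a : 'I_k.+2) :
  #|[set ts in U k.+2 | a \in moved (head 1 (rev ts))]| = (2 ^ k)%N.
Proof.
set c := long_cycle k.+2.
have cc : single_cycle c by exact: long_cycle_single.
have Mc : #|moved c| = k.+2 by exact: card_moved_long_cycle.
have ca : c a != a by exact: long_cycle_moves.
rewrite -(size_chains k c a) cardE -(size_map (fun ts : k.+1.-tuple 'S_k.+2 => rev ts)).
apply/perm_size/uniq_perm.
- by rewrite map_inj_uniq ?enum_uniq // => s t /(can_inj revK)/val_inj.
- exact: chains_uniq.
move=> us; rewrite mem_chains //.
apply/mapP/and3P => [[ts]|[/eqP sz cf ua]].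
  rewrite mem_enum inE mem_U => /andP[cf]; rewrite inE => ua ->.
  by rewrite size_rev size_tuple.
have sz' : size (rev us) == k.+1 by rewrite size_rev sz.
exists (Tuple sz'); last by rewrite /= revK.
by rewrite mem_enum inE mem_U /= revK cf inE.
Qed.

(** Double counting of the pairs (ts, a) such that ts is in U and its first
    applied factor moves a. *)
Lemma card_U k : (2 * #|U k.+2| = k.+2 * 2 ^ k)%N.
Proof.
rewrite -[in RHS](card_ord k.+2) -sum_nat_const.
rewrite -(eq_bigr _ (fun a _ => card_U_letter a)).
under eq_bigr => a _ do rewrite -sum1dep_card big_mkcondr /=.
rewrite exchange_big /= mulnC -sum_nat_const; apply: eq_bigr => ts.
rewrite (@mem_U k.+2) -big_mkcond sum1_card => /and3P[all_t _ _].
rewrite card_moved_transposition //.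
move: all_t; have: size (rev ts) = k.+1 by rewrite size_rev size_tuple.
by case: (rev ts) => //= u us _ /andP[].
Qed.

Theorem proposition1p3 (n : nat) (hn : (2 <= n)%N) :
  ((#|U n|%:R : rat) = n%:R * 2%:R ^ (n%:Z - 3%:Z))%R.
Proof.
case: n hn => [|[|k]] // _.
have nz2 : (2%:R != 0 :> rat)%R by [].
apply: (GRing.mulfI nz2).
rewrite -GRing.natrM card_U GRing.natrM GRing.natrX GRing.mulrCA; congr (_ * _)%R.
rewrite exprnP -[X in _ = (X * _)%R]expr1z -expfzDr //; congr (_ ^ _)%R; lia.
Qed.
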